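(* Let $m \geq 1$ be an integer. Suppose that $J$ is a $7 \times 7$ Jacobi matrix that realizes perfect state transfer and whose spectrum is $\{0, \pm 1, \pm 2m, \pm (2m+1)\}$. Then $J$ does not exhibit early state exclusion.
   Context: A Jacobi matrix of order $N+1$ is a real symmetric tridiagonal matrix $J$ with diagonal entries $a_1,\dots,a_{N+1}\in\mathbb{R}$ and off-diagonal entries $b_1,\dots,b_N>0$ (so $J_{i,i}=a_i$, $J_{i,i+1}=J_{i+1,i}=b_i$, all other entries zero). Let $\{\mathbf{e}_k\}_{k=0}^{N}$ be the canonical basis of $\mathbb{C}^{N+1}$, with $\mathbf{e}_0=[1,0,\dots,0]^\top$ and $\mathbf{e}_N=[0,\dots,0,1]^\top$, and let $\langle\cdot,\cdot\rangle$ be the standard inner product on $\mathbb{C}^{N+1}$. $J$ realizes perfect state transfer (PST) at time $T>0$ if $e^{-iJT}\mathbf{e}_0 = e^{i\phi}\mathbf{e}_N$ for some $\phi\in\mathbb{R}$; ''$J$ realizes PST'' means this holds for some $T>0$. If $J$ realizes PST and $T>0$ is the earliest time at which it does, then $J$ exhibits early state exclusion (ESE) at time $\tau$ if $\tau\in(0,T)$ and $\langle e^{-iJ\tau}\mathbf{e}_0,\mathbf{e}_0\rangle = 0$; $J$ exhibits ESE if it does so at some such $\tau$. Here $N+1=7$. *)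

(* Defs.v *)
From HB Require Import structures.
From mathcomp Require Import all_boot all_order all_algebra.
From mathcomp Require Import all_classical all_reals all_analysis.
Set Implicit Arguments. Unset Strict Implicit. Unset Printing Implicit Defensive.
Import Order.TTheory GRing.Theory Num.Theory.
Import numFieldNormedType.Exports.
Local Open Scope ring_scope.

Definition is_jacobi {R : realType} (J : 'M[R]_7) : Prop :=
  (forall i j : 'I_7, J i j = J j i) /\
  (forall i j : 'I_7, (i.+1 < j)%N -> J i j = 0) /\
  (forall i j : 'I_7, j = i.+1 :> nat -> 0 < J i j).

(* Entries of exp(-i J t) = cos(J t) - i sin(J t), given by the exponential
   power series sum_n (-i t)^n J^n / n!, split into real and imaginary parts
   (even and odd terms respectively). *)
Definition expJ_re {R : realType} (J : 'M[R]_7) (t : R) (i j : 'I_7) : R :=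
  limn (@series R (fun k : nat =>
    (-1) ^+ k * t ^+ (2 * k) / ((2 * k)`!)%:R * (J ^+ (2 * k)) i j) : R^nat).

Definition expJ_sin {R : realType} (J : 'M[R]_7) (t : R) (i j : 'I_7) : R :=
  limn (@series R (fun k : nat =>
    (-1) ^+ k * t ^+ (2 * k).+1 / ((2 * k).+1`!)%:R * (J ^+ (2 * k).+1) i j) : R^nat).

Definition expJ_im {R : realType} (J : 'M[R]_7) (t : R) (i j : 'I_7) : R :=
  - expJ_sin J t i j.

(* PST at time T: exp(-iJT) e_0 = e^{i phi} e_N, componentwise in real and
   imaginary parts. *)
Definition PST_at {R : realType} (J : 'M[R]_7) (T : R) : Prop :=
  0 < T /\ exists phi : R, forall i : 'I_7,
    expJ_re J T i ord0 = (if i == ord_max then cos phi else 0) /\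
    expJ_im J T i ord0 = (if i == ord_max then sin phi else 0).

Definition realizes_PST {R : realType} (J : 'M[R]_7) : Prop :=
  exists T, PST_at J T.

Definition earliest_PST {R : realType} (J : 'M[R]_7) (T : R) : Prop :=
  PST_at J T /\ forall t, 0 < t -> t < T -> ~ PST_at J t.

(* <exp(-iJ tau) e_0, e_0> is the (0,0) entry of exp(-iJ tau); it vanishes
   iff its real and imaginary parts both vanish. *)
Definition ESE_at {R : realType} (J : 'M[R]_7) (tau : R) : Prop :=
  exists T, earliest_PST J T /\ 0 < tau /\ tau < T /\
    expJ_re J tau ord0 ord0 = 0 /\ expJ_im J tau ord0 ord0 = 0.

Definition exhibits_ESE {R : realType} (J : 'M[R]_7) : Prop :=
  exists tau, ESE_at J tau.

(* Main.v *)
(** Write [P_k] for the spectral projector of [J] at the [k]-th eigenvalue [l_k]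
    and [p] for the characteristic polynomial. As [J] is tridiagonal, the corner
    entry of [P_k] is [b_1 ... b_6 / p'(l_k)]. State transfer forces
    [|P_k(0,0)| = |P_k(N,0)|], so [P_k(0,0) = b_1 ... b_6 / |p'(l_k)|]; moreover
    [P_k e_N = (-1)^k P_k e_0], which gives transfer at time [pi] already. Hence
    it is enough that the cosine sum [sum_k cos(l_k t) / |p'(l_k)|] be positive
    on ]0, pi[. Put [t = pi - s]. For [(4m+1) s <= 2 pi] this follows by
    integrating a second-order differential inequality. Otherwise, for [m >= 2],
    [sin(s/2) > 3/(4m+1)], and the sum is a positive definite quadratic form in
    [sin(m s)] and [cos(m s)], whose discriminant changes sign exactly at
    [sin(s/2) = 3/(4m+1)]. For [m = 1] it is a multiple of [sin(s/2)^6]. *)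

Require Import Defs.
From HB Require Import structures.
From mathcomp Require Import all_boot all_order all_algebra.
From mathcomp Require Import all_classical all_reals all_analysis.
From mathcomp Require Import zify ring lra.
Import Order.TTheory GRing.Theory Num.Theory.
Import numFieldNormedType.Exports.
Local Open Scope ring_scope.

(** * Spectral projectors of a matrix with simple spectrum *)

Section SpectralProjector.
Context {F : fieldType} {n : nat} (l : 'I_n.+1 -> F) (A : 'M[F]_n.+1).
Hypothesis l_inj : injective l.
Hypothesis l_eig : forall k, eigenvalue A (l k).

(** Lagrange basis at the points [l j]; evaluating it at [A] yields the projectors without
    diagonalising [A]. *)
Definition lagrange_poly (k : 'I_n.+1) : {poly F} :=
  \prod_(j | j != k) ((l k - l j)^-1 *: ('X - (l j)%:P)).

Definition spectral_proj (k : 'I_n.+1) : 'M[F]_n.+1 :=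
  horner_mx A (lagrange_poly k).

Lemma horner_lagrange_poly k j : (lagrange_poly k).[l j] = (j == k)%:R.
Proof.
rewrite horner_prod; case: eqVneq => [->|jk].
  rewrite big1 // => i ik; rewrite hornerZ hornerXsubC mulVf //.
  by rewrite subr_eq0 (inj_eq l_inj) eq_sym.
by rewrite (bigD1 j) //= hornerZ hornerXsubC subrr mulr0 mul0r.
Qed.

Lemma lagrange_polyE k :
  lagrange_poly k = (\prod_(j | j != k) (l k - l j)^-1) *:
                    \prod_(j | j != k) ('X - (l j)%:P).
Proof. by rewrite /lagrange_poly scaler_prod. Qed.

Lemma lagrange_polyN k :
  lagrange_poly k = (\prod_(j | j != k) (l k - l j)^-1) *:
     \prod_(x <- [seq l j | j <- enum 'I_n.+1 & j != k]) ('X - x%:P).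
Proof. by rewrite lagrange_polyE big_map big_filter big_enum_cond. Qed.

Lemma size_points k : size [seq l j | j <- enum 'I_n.+1 & j != k] = n.
Proof.
rewrite size_map size_filter; have := count_predC (pred1 k) (enum 'I_n.+1).
by rewrite -cardE card_ord count_uniq_mem ?enum_uniq // mem_enum inE => -[].
Qed.

Lemma size_lagrange_poly k : (size (lagrange_poly k) <= n.+1)%N.
Proof.
rewrite lagrange_polyN; apply: leq_trans (size_scale_leq _ _) _.
by rewrite size_prod_XsubC size_points.
Qed.

Lemma coef_lagrange_poly k :
  (lagrange_poly k)`_n = \prod_(j | j != k) (l k - l j)^-1.
Proof.
rewrite lagrange_polyN coefZ; set p := \prod_(x <- _) _.
have /monicP : p \is monic by apply: monic_prod_XsubC.
by rewrite /lead_coef size_prod_XsubC size_points => ->; rewrite mulr1.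
Qed.

Lemma uniq_points : uniq [seq l j | j <- enum 'I_n.+1].
Proof. by rewrite map_inj_uniq // enum_uniq. Qed.

(** Both sides have degree at most [n] and agree at the [n.+1] distinct points [l j]. *)
Lemma sum_lagrange_poly : \sum_k lagrange_poly k = 1.
Proof.
apply/eqP; rewrite -subr_eq0; apply/eqP.
apply: (@roots_geq_poly_eq0 _ _ [seq l j | j <- enum 'I_n.+1]).
- apply/allP => _ /mapP[j _ ->]; rewrite /root hornerD hornerN horner_sum hornerC.
  rewrite (bigD1 j) //= horner_lagrange_poly eqxx big1 ?addr0 ?subrr // => i ij.
  by rewrite horner_lagrange_poly eq_sym (negbTE ij).
- exact: uniq_points.
- rewrite size_map size_enum_ord (leq_trans (size_polyD _ _)) // geq_max.
  rewrite size_polyN size_poly1 andbT (leq_trans (size_sum _ _ _)) //.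
  by apply/bigmax_leqP => i _; apply: size_lagrange_poly.
Qed.

Lemma char_poly_eigenvalues : char_poly A = \prod_j ('X - (l j)%:P).
Proof.
rewrite (@all_roots_prod_XsubC _ (char_poly A) [seq l j | j <- enum 'I_n.+1]).
- by rewrite (monicP (char_poly_monic A)) scale1r big_map big_enum.
- by rewrite size_char_poly size_map size_enum_ord.
- by apply/allP => _ /mapP[j _ ->]; rewrite -eigenvalue_root_char.
- by rewrite uniq_rootsE uniq_points.
Qed.

(** Multiplying [lagrange_poly k] by its missing factor gives a multiple of the characteristic
    polynomial, which Cayley-Hamilton kills. *)
Lemma mulmx_spectral_proj k : A *m spectral_proj k = l k *: spectral_proj k.
Proof.
apply/eqP; rewrite -subr_eq0 -mul_scalar_mx -mulmxBl; apply/eqP.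
rewrite -{1}(horner_mx_X A) -(horner_mx_C A) -rmorphB /= /spectral_proj.
rewrite mulmxE -rmorphM /= lagrange_polyE -scalerAr horner_mxZ.
rewrite -(bigD1 k (P := xpredT) (F := fun j => 'X - (l j)%:P)) //=.
by rewrite -char_poly_eigenvalues Cayley_Hamilton scaler0.
Qed.

Lemma horner_spectral_proj q k :
  horner_mx A q *m spectral_proj k = q.[l k] *: spectral_proj k.
Proof.
elim/poly_ind: q => [|q c IH]; first by rewrite rmorph0 mul0mx horner0 scale0r.
rewrite rmorphD rmorphM /= horner_mx_X horner_mx_C mulmxDl -mulmxE -mulmxA.
rewrite mulmx_spectral_proj -scalemxAr IH hornerMXaddC mul_scalar_mx scalerA.
by rewrite mulrC scalerDl.
Qed.

Lemma spectral_projM k j :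
  spectral_proj k *m spectral_proj j = (j == k)%:R *: spectral_proj j.
Proof. by rewrite horner_spectral_proj horner_lagrange_poly. Qed.

Lemma sum_spectral_proj : \sum_k spectral_proj k = 1%:M.
Proof. by rewrite -rmorph_sum /= sum_lagrange_poly rmorph1. Qed.

Lemma expmx_spectral r : A ^+ r = \sum_k (l k ^+ r) *: spectral_proj k.
Proof.
rewrite -[LHS]mulmx1 -sum_spectral_proj mulmx_sumr; apply: eq_bigr => k _.
by rewrite -{1}(horner_mx_X A) -rmorphXn /= horner_spectral_proj hornerXn.
Qed.

Lemma tr_spectral_proj k : A^T = A -> (spectral_proj k)^T = spectral_proj k.
Proof.
move=> symA.
have symX r : (A ^+ r)^T = A ^+ r.
  elim: r => [|r IH]; first by rewrite expr0 trmx1.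
  by rewrite exprS trmx_mul IH symA mulmxE -exprSr exprS.
rewrite /spectral_proj; elim/poly_ind: (lagrange_poly k) => [|q c IH].
  by rewrite rmorph0 trmx0.
rewrite rmorphD rmorphM /= horner_mx_X horner_mx_C linearD /= tr_scalar_mx.
by rewrite trmx_mul IH symA; congr (_ + _); exact: comm_mx_horner.
Qed.

(** [lagrange_poly k] has degree [n], so only its leading term survives at an entry where the lower
    powers vanish. *)
Lemma spectral_proj_coef k i j : (forall r, (r < n)%N -> (A ^+ r) i j = 0) ->
  spectral_proj k i j = (A ^+ n) i j * \prod_(s | s != k) (l k - l s)^-1.
Proof.
move=> A0; rewrite /spectral_proj -coef_lagrange_poly.
rewrite -{1}(take_poly_id (size_lagrange_poly k)) /take_poly poly_def rmorph_sum /=.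
rewrite summxE big_ord_recr /= big1 => [|r _].
  by rewrite add0r horner_mxZ rmorphXn /= horner_mx_X mxE mulrC.
by rewrite horner_mxZ rmorphXn /= horner_mx_X mxE A0 ?mulr0.
Qed.

End SpectralProjector.

(** * A trigonometric inequality *)

Lemma derive_gt0_lt {R : realType} (f df : R -> R) (a b : R) : a < b ->
  (forall x : R, is_derive x 1 f (df x)) ->
  (forall x, a < x < b -> 0 < df x) -> f a < f b.
Proof.
move=> ab fd df0; rewrite -subr_gt0.
have [|c /[!in_itv]/= /df0 c0 ->] := MVT ab (fun x _ => fd x).
  apply: continuous_subspaceT => x; apply: differentiable_continuous.
  by apply/derivable1_diffP; apply: ex_derive.
by rewrite mulr_gt0 // subr_gt0.
Qed.

Lemma derive_ge0_le {R : realType} (f df : R -> R) (a b : R) : a <= b ->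
  (forall x : R, is_derive x 1 f (df x)) ->
  (forall x, a <= x <= b -> 0 <= df x) -> f a <= f b.
Proof.
move=> ab fd df0; rewrite -subr_ge0.
have [|c /[!in_itv]/= /df0 c0 ->] := MVT_segment ab (fun x _ => fd x).
  apply: continuous_subspaceT => x; apply: differentiable_continuous.
  by apply/derivable1_diffP; apply: ex_derive.
by rewrite mulr_ge0 // subr_ge0.
Qed.

Lemma is_derive_sinZ {R : realType} (c x : R) :
  is_derive x 1 (fun u => sin (c * u)) (c * cos (c * x)).
Proof.
have H : is_derive x 1 ( *%R c) c.
  by apply: is_derive_eq; rewrite /GRing.scale /= mulr1.
apply: (is_derive_eq (@is_derive1_comp R sin ( *%R c) x _ _ (is_derive_sin (c * x)) H)).
by rewrite mulrC.
Qed.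

Lemma is_derive_cosZ {R : realType} (c x : R) :
  is_derive x 1 (fun u => cos (c * u)) (- c * sin (c * x)).
Proof.
have H : is_derive x 1 ( *%R c) c.
  by apply: is_derive_eq; rewrite /GRing.scale /= mulr1.
apply: (is_derive_eq (@is_derive1_comp R cos ( *%R c) x _ _ (is_derive_cos (c * x)) H)).
by rewrite mulrC mulrN mulNr.
Qed.

Lemma is_derive_sinB {R : realType} (s x : R) :
  is_derive x 1 (fun u => sin (s - u)) (- cos (s - x)).
Proof.
have H : is_derive x 1 (fun u => s - u) (-1).
  by apply: is_derive_eq; rewrite add0r mul1r.
apply: (is_derive_eq (@is_derive1_comp R sin _ x _ _ (is_derive_sin (s - x)) H)).
by rewrite mulrN1.
Qed.

Lemma is_derive_cosB {R : realType} (s x : R) :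
  is_derive x 1 (fun u => cos (s - u)) (sin (s - x)).
Proof.
have H : is_derive x 1 (fun u => s - u) (-1).
  by apply: is_derive_eq; rewrite add0r mul1r.
apply: (is_derive_eq (@is_derive1_comp R cos _ x _ _ (is_derive_cos (s - x)) H)).
by rewrite mulrN1 opprK.
Qed.

(** * Polynomial bounds for sine and cosine, and a lower bound for [pi] *)

Lemma sin_le_id {R : realType} (x : R) : 0 <= x -> sin x <= x.
Proof.
move=> x0; rewrite -subr_ge0.
pose f := (fun u : R => u - sin u).
have -> : 0 = f 0 by rewrite /f sin0 subrr.
have fd (u : R) : is_derive u 1 f (1 - cos u) by exact: is_derive_eq.
by apply: (@derive_ge0_le _ f _ _ _ x0 fd) => u _; rewrite subr_ge0 cos_le1.
Qed.

Lemma cos_ge_quadratic {R : realType} (x : R) : 0 <= x -> 1 - x ^+ 2 / 2 <= cos x.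
Proof.
move=> x0; have -> : x = (x / 2) *+ 2 by lra.
have h0 : 0 <= x / 2 by lra.
rewrite cos_mulr2n cos2sin2.
have : `|sin (x / 2)| ^+ 2 <= (x / 2) ^+ 2.
  rewrite ler_pXn2r ?nnegrE ?normr_ge0 // ler_norml sin_le_id // andbT.
  (* Lower bound [- (x / 2)]: sine is nonnegative up to [pi], and past it [x / 2] exceeds 2. *)
  have [hpi|hpi] := leP (x / 2) pi.
    by apply: le_trans (_ : 0 <= _); [lra | rewrite sin_ge0_pi // h0].
  by have := sin_geN1 (x / 2); have := pi_ge2 R; lra.
rewrite real_normK ?num_real // => H; lra.
Qed.

Lemma sin_ge_cubic {R : realType} (x : R) : 0 <= x -> x - x ^+ 3 / 6 <= sin x.
Proof.
move=> x0; rewrite -subr_ge0.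
pose f := (fun u : R => sin u - (u - u ^+ 3 / 6)).
have -> : 0 = f 0 by rewrite /f sin0; lra.
have fd (u : R) : is_derive u 1 f (cos u - (1 - u ^+ 2 / 2)).
  by apply: is_derive_eq; rewrite /GRing.scale /=; field.
apply: (@derive_ge0_le _ f _ _ _ x0 fd) => u.
by move=> /andP[u0 _]; rewrite subr_ge0 cos_ge_quadratic.
Qed.

(** The quadratic bound at [153 / 200] followed by angle doubling gives [0 < cos (153 / 100)], hence
    [153 / 100 < pi / 2]. *)
Lemma pi_gt_306 {R : realType} : 306 / 100 < pi :> R.
Proof.
rewrite ltNge; apply/negP => pile.
have c0 : 0 < cos (153 / 100 : R).
  have -> : 153 / 100 = (153 / 200) *+ 2 :> R by lra.
  rewrite cos_mulr2n.
  have := @cos_ge_quadratic R (153 / 200) ltac:(lra); nra.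
have p2 := pi_ge2 R; have pl := pihalf_ge1 R.
have : cos (153 / 100) <= cos (pi / 2 : R).
  by rewrite leNgt ltr_cos ?in_itv /= -?leNgt; lra.
by rewrite cos_pihalf; lra.
Qed.

Lemma cosB_cos {R : realType} (p q : R) :
  cos (p - q) - cos (p + q) = 2 * (sin p * sin q).
Proof. by rewrite cosB cosD; ring. Qed.

(** * Positivity of the weighted cosine sum *)

Section WeightedCosineSum.
Context {R : realType} (M : R).

(* Up to a positive factor, the sum of [cos (l_k * t) / |p'(l_k)|] at
   [t = pi - s], for [M = m]; the factors [1 * s] let [is_derive_cosZ] and
   [is_derive_sinZ] apply to every term. *)
Definition cos_sum (s : R) : R :=
  (M + 1) * (2 * M - 1) * (4 * M + 1) - M * (2 * M + 1) * (4 * M + 1) * cos (1 * s)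
  + (M + 1) * (2 * M + 1) * cos (2 * M * s)
  - M * (2 * M - 1) * cos ((2 * M + 1) * s).

(** The derivative of [cos_sum] divided by [M * (2 * M + 1)]; [dsin_sum] is its own derivative. *)
Definition sin_sum (s : R) : R :=
  (4 * M + 1) * sin (1 * s) - 2 * (M + 1) * sin (2 * M * s)
  + (2 * M - 1) * sin ((2 * M + 1) * s).

Definition dsin_sum (s : R) : R :=
  (4 * M + 1) * cos (1 * s) - 4 * M * (M + 1) * cos (2 * M * s)
  + (2 * M - 1) * (2 * M + 1) * cos ((2 * M + 1) * s).

Definition sin_gap (s : R) : R :=
  (2 * M + 1) * sin (2 * M * s) - 2 * M * sin ((2 * M + 1) * s).

(** The derivative is a positive multiple of [sin ((4 * M + 1) * u / 2) * sin (u / 2)]; the range of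
    [s] keeps the first angle below [pi]. *)
Lemma sin_gap_gt0 (s : R) : 1 <= M -> 0 < s -> (4 * M + 1) * s <= 2 * pi -> 0 < sin_gap s.
Proof.
move=> M1 s0 sle.
have -> : 0 = sin_gap 0 by rewrite /sin_gap !mulr0 sin0 !mulr0 subrr.
have kd (u : R) : is_derive u 1 sin_gap
    (2 * M * (2 * M + 1) * (cos (2 * M * u) - cos ((2 * M + 1) * u))).
  have := is_derive_sinZ (2 * M) u; have := is_derive_sinZ (2 * M + 1) u => d1 d2.
  by apply: is_derive_eq; rewrite /GRing.scale /=; ring.
apply: (@derive_gt0_lt _ sin_gap _ _ _ s0 kd) => u /andP[u0 us].
rewrite pmulr_rgt0; last by rewrite !mulr_gt0 //; lra.
have p0 : 0 <= (M - 1) * u by rewrite mulr_ge0 //; lra.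
have p1 : 0 < M * (s - u) by rewrite mulr_gt0 ?subr_gt0 //; lra.
have p2 : 0 <= (M - 1) * s by rewrite mulr_ge0 //; lra.
have -> : 2 * M * u = (4 * M + 1) * u / 2 - u / 2 by field.
have -> : (2 * M + 1) * u = (4 * M + 1) * u / 2 + u / 2 by field.
rewrite cosB_cos pmulr_rgt0 // mulr_gt0 // sin_gt0_pi //; apply/andP; split; lra.
Qed.

(* Variation of constants for [h = sin_sum]: [h 0 = h' 0 = 0] and
   [h'' + h = 2 (M + 1) (2 M - 1) sin_gap >= 0], while
   [u |-> h' u * sin (s - u) + h u * cos (s - u)] goes from [0] to [h s] with
   derivative [(h'' + h) u * sin (s - u)]. *)
Lemma sin_sum_gt0 (s : R) : 1 <= M -> 0 < s -> (4 * M + 1) * s <= 2 * pi -> 0 < sin_sum s.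
Proof.
move=> M1 s0 sle.
pose V (u : R) := dsin_sum u * sin (s - u) + sin_sum u * cos (s - u).
have Vd (u : R) : is_derive u 1 V (2 * (M + 1) * (2 * M - 1) * sin_gap u * sin (s - u)).
  have := is_derive_sinZ 1 u; have := is_derive_sinZ (2 * M) u.
  have := is_derive_sinZ (2 * M + 1) u => d1 d2 d3.
  have := is_derive_cosZ 1 u; have := is_derive_cosZ (2 * M) u.
  have := is_derive_cosZ (2 * M + 1) u => e1 e2 e3.
  have := is_derive_sinB s u; have := is_derive_cosB s u => f1 f2.
  have hd : is_derive u 1 sin_sum (dsin_sum u).
    by apply: is_derive_eq; rewrite /dsin_sum /GRing.scale /=; ring.
  have dhd : is_derive u 1 dsin_sum (2 * (M + 1) * (2 * M - 1) * sin_gap u - sin_sum u).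
    by apply: is_derive_eq; rewrite /sin_gap /sin_sum /GRing.scale /=; ring.
  by apply: is_derive_eq; rewrite /GRing.scale /=; ring.
have V0 : V 0 = 0.
  by rewrite /V /dsin_sum /sin_sum !mulr0 !sin0 cos0; ring.
have Vs : V s = sin_sum s by rewrite /V subrr sin0 cos0; ring.
rewrite -V0 -Vs; apply: (@derive_gt0_lt _ V _ _ _ s0 Vd) => u /andP[u0 us].
rewrite mulr_gt0 //; last first.
  by apply: sin_gt0_pi; apply/andP; split; have := pi_gt0 R; nra.
by rewrite mulr_gt0 ?sin_gap_gt0 //; nra.
Qed.

Lemma cos_sum_gt0_small (s : R) : 1 <= M -> 0 < s ->
  (4 * M + 1) * s <= 2 * pi -> 0 < cos_sum s.
Proof.
move=> M1 s0 sle.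
have -> : 0 = cos_sum 0 by rewrite /cos_sum !mulr0 !cos0; ring.
have gd (u : R) : is_derive u 1 cos_sum (M * (2 * M + 1) * sin_sum u).
  have := is_derive_cosZ 1 u; have := is_derive_cosZ (2 * M) u.
  have := is_derive_cosZ (2 * M + 1) u => e1 e2 e3.
  by apply: is_derive_eq; rewrite /sin_sum /GRing.scale /=; ring.
apply: (@derive_gt0_lt _ cos_sum _ _ _ s0 gd) => u /andP[u0 us].
by rewrite mulr_gt0 ?sin_sum_gt0 //; nra.
Qed.

(** Each cosine is [1 - 2 sin^2] of the half angle; the constants cancel because [cos_sum 0 = 0]. *)
Lemma cos_sum_half_angle (t : R) : cos_sum (t *+ 2) =
  2 * (M * (2 * M + 1) * (4 * M + 1) * sin t ^+ 2
       + M * (2 * M - 1) * sin ((2 * M + 1) * t) ^+ 2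
       - (M + 1) * (2 * M + 1) * sin (2 * M * t) ^+ 2).
Proof. by rewrite /cos_sum !mulrnAr !cos_mulr2n !cos2sin2 mul1r; ring. Qed.

(** Expanding [sin ((2 * M + 1) * t)] leaves a quadratic form in [B] and [D] with coefficients [a],
    [2 * b], [d]; the hypothesis on [sin t] makes [a * d - b ^+ 2] positive. *)
Lemma cos_sum_gt0_large (t : R) : 1 <= M -> 0 < sin t ->
  3 < (4 * M + 1) * sin t -> 0 < cos_sum (t *+ 2).
Proof.
move=> M1 S0 S3; rewrite cos_sum_half_angle pmulr_rgt0 //.
have -> : (2 * M + 1) * t = 2 * M * t + t by ring.
rewrite sinD; have := cos2Dsin2 (2 * M * t); have := cos2Dsin2 t.
move: S0 S3; set S := sin t; set C := cos t.
set B := sin (2 * M * t); set D := cos (2 * M * t) => S0 S3 CS DB.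
pose a := S ^+ 2 * (8 * M ^+ 3 + 4 * M ^+ 2 + 2 * M) - (4 * M + 1).
pose b := M * (2 * M - 1) * S * C.
pose d := 8 * M ^+ 2 * (M + 1) * S ^+ 2.
have d0 : 0 < d by rewrite /d !mulr_gt0 ?exprn_gt0 //; lra.
have disc : a * d - b ^+ 2 =
    M ^+ 2 * S ^+ 2 * (2 * M + 1) ^+ 2 * (((4 * M + 1) * S) ^+ 2 - 9).
  have C2 : C ^+ 2 = 1 - S ^+ 2 by lra.
  by rewrite /b !exprMn C2 /a /d; ring.
have disc0 : 0 < a * d - b ^+ 2.
  have S9 : 0 < ((4 * M + 1) * S) ^+ 2 - 9.
    rewrite (_ : _ - 9 = ((4 * M + 1) * S - 3) * ((4 * M + 1) * S + 3)); last by ring.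
    by rewrite mulr_gt0 //; lra.
  by rewrite disc !mulr_gt0 ?exprn_gt0 //; lra.
set G := (X in 0 < X).
have GE : G = a * B ^+ 2 + 2 * b * B * D + d * D ^+ 2.
  have C2 : C ^+ 2 = 1 - S ^+ 2 by lra.
  (* [D ^+ 2 + B ^+ 2 = 1] makes the pure [S ^+ 2] term homogeneous. *)
  have -> : G = M * (2 * M + 1) * (4 * M + 1) * S ^+ 2 * (D ^+ 2 + B ^+ 2)
       + M * (2 * M - 1) * (B ^+ 2 * C ^+ 2 + 2 * B * C * S * D + S ^+ 2 * D ^+ 2)
       - (M + 1) * (2 * M + 1) * B ^+ 2 by rewrite DB /G; ring.
  by rewrite C2 /a /b /d; ring.
rewrite -(pmulr_rgt0 _ d0).
have -> : d * G = (b * B + d * D) ^+ 2 + (a * d - b ^+ 2) * B ^+ 2.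
  by rewrite GE; ring.
have [B0|Bn0] := eqVneq B 0.
  have D2 : D ^+ 2 = 1 by rewrite -DB B0; ring.
  by rewrite B0 mulr0 add0r exprMn D2 expr0n mulr0 addr0 mulr1 exprn_gt0.
by rewrite ltr_wpDl ?sqr_ge0 // mulr_gt0 // exprn_even_gt0.
Qed.

End WeightedCosineSum.

(** This is [cos_sum] at [pi - t]: the substitution flips the sign of the odd frequencies only. *)
Lemma weighted_cos_sum_gt0 {R : realType} (m : nat) (t : R) : (1 <= m)%N ->
  0 < t < pi ->
  0 < (m%:R + 1) * (2 * m%:R - 1) * (4 * m%:R + 1)
      + m%:R * (2 * m%:R + 1) * (4 * m%:R + 1) * cos t
      + (m%:R + 1) * (2 * m%:R + 1) * cos ((2 * m)%:R * t)
      + m%:R * (2 * m%:R - 1) * cos ((2 * m).+1%:R * t).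
Proof.
move=> m1 /andP[t0 tpi]; set M : R := m%:R.
have M1 : 1 <= M by rewrite /M ler1n.
have cosmpi (j : nat) (x : R) : cos (j%:R * (pi - x)) = (-1) ^+ j * cos (j%:R * x).
  rewrite mulrBr addrC [j%:R * pi]mulrC mulr_natr.
  by rewrite (alternatingn (@cosDpi R)) cosN.
have sE : cos_sum M (pi - t) = (M + 1) * (2 * M - 1) * (4 * M + 1)
      + M * (2 * M + 1) * (4 * M + 1) * cos t
      + (M + 1) * (2 * M + 1) * cos ((2 * m)%:R * t)
      + M * (2 * M - 1) * cos ((2 * m).+1%:R * t).
  have E1 : cos (1 * (pi - t)) = - cos t.
    by rewrite (cosmpi 1%N) expr1 mul1r mulN1r.
  have E2 : cos (2 * M * (pi - t)) = cos ((2 * m)%:R * t).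
    by rewrite -natrM cosmpi exprM sqrrN !expr1n mul1r.
  have E3 : cos ((2 * M + 1) * (pi - t)) = - cos ((2 * m).+1%:R * t).
    by rewrite -natrM natr1 cosmpi exprS exprM sqrrN !expr1n mulr1 mulN1r.
  by rewrite /cos_sum E1 E2 E3; ring.
rewrite -sE.
have [small|large] := leP ((4 * M + 1) * (pi - t)) (2 * pi).
  by apply: cos_sum_gt0_small => //; lra.
pose x := (pi - t) / 2.
have xE : pi - t = x *+ 2 by rewrite /x; lra.
have x0 : 0 < x by rewrite /x; lra.
have xpi : x < pi / 2 by rewrite /x; lra.
have S0 : 0 < sin x by apply: sin_gt0_pihalf; rewrite x0.
(* For [m = 1] only [pi / 5 < x] is known, and [5 * sin (pi / 5) < 3], so the sum is computed
   outright as [32 * sin x ^+ 6]. *)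
rewrite xE; have [m_1|m_n1] := eqVneq m 1%N.
  have M_1 : M = 1 by rewrite /M m_1.
  rewrite cos_sum_half_angle M_1 !mulr1 (_ : 2 + 1 = 3 :> R); last by ring.
  have -> : 3 * x = x *+ 2 + x by ring.
  have -> : 2 * x = x *+ 2 by ring.
  rewrite sinD sin_mulr2n cos_mulr2n.
  have C2 := cos2sin2 x.
  have -> : (cos x * sin x *+ 2 * cos x + (cos x ^+ 2 *+ 2 - 1) * sin x)
      = 3 * sin x - 4 * sin x ^+ 3.
    rewrite (_ : cos x * sin x *+ 2 * cos x = cos x ^+ 2 * sin x *+ 2); last by ring.
    by rewrite C2; ring.
  have -> : (cos x * sin x *+ 2) ^+ 2 = 4 * (1 - sin x ^+ 2) * sin x ^+ 2.
    by rewrite -C2; ring.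
  rewrite [ltRHS](_ : _ = 32 * sin x ^+ 6); last by ring.
  by rewrite mulr_gt0 // exprn_gt0.
have M2 : 2 <= M by rewrite /M ler_nat; lia.
apply: cos_sum_gt0_large => //.
(* Since [N * x > pi > 3.06], [sin x] exceeds [sin y] with [N * y = 3.06]. As
   [y <= 3.06 / 9 = 0.34], the cubic bound gives [N * sin y >= 3.06 * (1 - y ^+ 2 / 6) > 3]. *)
pose N := 4 * M + 1; have N9 : 9 <= N by rewrite /N; lra.
pose y := 306 / 100 / N; have y0 : 0 < y by rewrite /y divr_gt0 //; lra.
have yN : N * y = 306 / 100 by rewrite /y; field; apply: lt0r_neq0; lra.
have yx : y < x.
  have N0 : 0 < N by lra.
  rewrite -(ltr_pM2l N0) yN; have := @pi_gt_306 R.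
  by rewrite xE in large; rewrite /N; lra.
have yS : sin y < sin x.
  by rewrite ltr_sin ?in_itv //=; apply/andP; split; lra.
have yc := sin_ge_cubic _ (ltW y0).
have y34 : y <= 34 / 100.
  have : 0 <= (N - 9) * y by rewrite mulr_ge0 //; lra.
  by lra.
have : N * (y - y ^+ 3 / 6) <= N * sin y by rewrite ler_pM2l //; lra.
have : N * sin y < N * sin x by rewrite ltr_pM2l //; lra.
have -> : N * (y - y ^+ 3 / 6) = N * y - N * y * y ^+ 2 / 6 by ring.
have y2 : y ^+ 2 <= 1156 / 10000.
  by rewrite (_ : 1156 / 10000 = (34 / 100) ^+ 2) ?lerXn2r ?nnegrE //; lra.
by rewrite yN -/N; lra.
Qed.

(** * Spectral form of the evolution *)

(** Expanding the powers of [J] over the projectors makes each partial sum a finite combination of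
    partial cosine series, whose convergence shows that [limn] is a true limit. *)
Lemma expJ_re_spectral {R : realType} (J : 'M[R]_7) (l : 'I_7 -> R) (t : R) i j :
  injective l -> (forall k, eigenvalue J (l k)) ->
  expJ_re J t i j = \sum_k cos (l k * t) * spectral_proj l J k i j.
Proof.
move=> l_inj l_eig; apply: cvg_lim => //.
rewrite (_ : series _ = fun N => \sum_k series (cos_coeff' (l k * t)) N *
                                       spectral_proj l J k i j); last first.
  apply/funext => N; rewrite /series /=.
  under [RHS]eq_bigr do rewrite mulr_suml.
  rewrite exchange_big /=; apply: eq_bigr => r _.
  rewrite (expmx_spectral l) // summxE mulr_sumr; apply: eq_bigr => k _.
  by rewrite mxE /cos_coeff' -mul2n exprMn -exprnP; ring.
apply: cvg_big => [|k _]; [exact: add_continuous|]; apply: cvgMr_tmp; exact: cvg_cos_coeff'.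
Qed.

Lemma expJ_sin_spectral {R : realType} (J : 'M[R]_7) (l : 'I_7 -> R) (t : R) i j :
  injective l -> (forall k, eigenvalue J (l k)) ->
  expJ_sin J t i j = \sum_k sin (l k * t) * spectral_proj l J k i j.
Proof.
move=> l_inj l_eig; apply: cvg_lim => //.
rewrite (_ : series _ = fun N => \sum_k series (sin_coeff' (l k * t)) N *
                                       spectral_proj l J k i j); last first.
  apply/funext => N; rewrite /series /=.
  under [RHS]eq_bigr do rewrite mulr_suml.
  rewrite exchange_big /=; apply: eq_bigr => r _.
  rewrite (expmx_spectral l) // summxE mulr_sumr; apply: eq_bigr => k _.
  by rewrite mxE /sin_coeff' -mul2n exprMn -exprnP; ring.
apply: cvg_big => [|k _]; [exact: add_continuous|]; apply: cvgMr_tmp; exact: cvg_sin_coeff'.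
Qed.

(** Each factor [J] extends the support of the first column by one row, multiplying its lowest entry
    by a positive off-diagonal entry. *)
Lemma jacobi_pow_col0 {R : realType} (J : 'M[R]_7) (r : nat) : is_jacobi J ->
  (forall i : 'I_7, (r < i)%N -> (J ^+ r) i ord0 = 0) /\
  (forall i : 'I_7, i = r :> nat -> 0 < (J ^+ r) i ord0).
Proof.
move=> [sym [tri pos]]; elim: r => [|r [IH0 IHp]].
  split=> i; rewrite expr0 mxE.
    by case: eqVneq => [->|].
  by move=> i0; rewrite (_ : i = ord0) ?eqxx ?ltr01 //; apply: val_inj.
split=> i ir; rewrite exprS mxE.
  rewrite big1 // => s _; have [rs|sr] := ltnP r s; first by rewrite IH0 ?mulr0.
  by rewrite sym tri ?mul0r //; apply: leq_ltn_trans ir.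
have r7 : (r < 7)%N by have := ltn_ord i; lia.
rewrite (bigD1 (Ordinal r7)) //= big1 ?addr0 => [|s sr].
  by rewrite mulr_gt0 ?IHp // sym pos.
have [rs|rs|rs] := ltngtP r s; first by rewrite IH0 ?mulr0.
  by rewrite sym tri ?mul0r // ir ltnS.
by case/eqP: sr; apply: val_inj.
Qed.

(** * The spectrum of the theorem *)

(** Increasing order, so that signs at the [k]-th node alternate with [k]. *)
Definition spectrum_node {R : realType} (M : R) (k : 'I_7) : R :=
  nth 0 [:: - (2 * M + 1); - (2 * M); -1; 0; 1; 2 * M; 2 * M + 1] k.

(* Absolute values at the nodes of the derivative of the characteristic
   polynomial. *)
Definition node_deriv {R : realType} (M : R) (k : 'I_7) : R :=
  nth 0 [:: 8 * M * (M + 1) * (2 * M + 1) ^+ 2 * (4 * M + 1);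
            8 * M ^+ 2 * (2 * M - 1) * (2 * M + 1) * (4 * M + 1);
            8 * M * (M + 1) * (2 * M - 1) * (2 * M + 1);
            4 * M ^+ 2 * (2 * M + 1) ^+ 2;
            8 * M * (M + 1) * (2 * M - 1) * (2 * M + 1);
            8 * M ^+ 2 * (2 * M - 1) * (2 * M + 1) * (4 * M + 1);
            8 * M * (M + 1) * (2 * M + 1) ^+ 2 * (4 * M + 1)] k.

Lemma spectrum_node_inj {R : realType} (M : R) : 1 <= M -> injective (spectrum_node M).
Proof.
move=> M1 i j; suff H (a b : 'I_7) : (a < b)%N -> spectrum_node M a < spectrum_node M b.
  move=> ij; apply: val_inj; case: (ltngtP i j) => // /H; by rewrite ij ltxx.
move: a b => [[|[|[|[|[|[|[|//]]]]]]] ?] [[|[|[|[|[|[|[|//]]]]]]] ?] //= _;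
  rewrite /spectrum_node /=; lra.
Qed.

(** The [6 - k] nodes above the [k]-th give the negative factors, hence the sign. *)
Lemma prod_node_diff {R : realType} (M : R) (k : 'I_7) : 1 <= M ->
  \prod_(s | s != k) (spectrum_node M k - spectrum_node M s)^-1 = (-1) ^+ k / node_deriv M k.
Proof.
move=> M1; rewrite big_mkcond !big_ord_recl big_ord0 /spectrum_node /node_deriv.
have n1 : M != 0 by apply: lt0r_neq0; lra.
have n2 : M + 1 != 0 by apply: lt0r_neq0; lra.
have n3 : 2 * M + 1 != 0 by apply: lt0r_neq0; lra.
have n4 : 2 * M - 1 != 0 by apply: lt0r_neq0; lra.
have n5 : 4 * M + 1 != 0 by apply: lt0r_neq0; lra.
case: k => [[|[|[|[|[|[|[|//]]]]]]] k7] /=; field;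
  do ?[apply/andP; split] => //;
  first [by apply: lt0r_neq0; lra | by apply: ltr0_neq0; lra].
Qed.

Lemma node_deriv_gt0 {R : realType} (M : R) (k : 'I_7) : 1 <= M -> 0 < node_deriv M k.
Proof.
move=> M1; rewrite /node_deriv.
by case: k => [[|[|[|[|[|[|[|//]]]]]]] k7] /=; rewrite !mulr_gt0 ?exprn_gt0 //; lra.
Qed.

Lemma cos_natpi {R : realType} (n : nat) : cos (n%:R * pi) = (-1) ^+ n :> R.
Proof. by rewrite mulr_natl -[_ *+ n]add0r (alternatingn (@cosDpi R)) cos0 mulr1. Qed.

Lemma sin_natpi {R : realType} (n : nat) : sin (n%:R * pi) = 0 :> R.
Proof. by rewrite mulr_natl -[_ *+ n]add0r (alternatingn (@sinDpi R)) sin0 mulr0. Qed.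

(** Parity alternates along the ordered spectrum: the arithmetic reason for transfer at time
    [pi]. *)
Lemma spectrum_node_nat {R : realType} (m : nat) (k : 'I_7) : exists j : nat,
  [/\ odd j = ~~ odd k &
      spectrum_node (m%:R : R) k = j%:R \/ spectrum_node (m%:R : R) k = - j%:R].
Proof.
exists (nth 0%N [:: (2 * m).+1; 2 * m; 1; 0; 1; 2 * m; (2 * m).+1]%N k).
rewrite /spectrum_node -!natrM !natr1.
by case: k => [[|[|[|[|[|[|[|//]]]]]]] k7] /=; rewrite ?oppr0 ?mul2n ?odd_double //=;
  split => //; [right|right|right|left|left|left|left].
Qed.

Lemma cos_spectrum_node_pi {R : realType} (m : nat) (k : 'I_7) :
  cos (spectrum_node (m%:R : R) k * pi) = - (-1) ^+ k.
Proof.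
have [j [jk jE]] := @spectrum_node_nat R m k.
have -> : cos (spectrum_node (m%:R : R) k * pi) = cos (j%:R * pi).
  by case: jE => ->; rewrite // mulNr cosN.
by rewrite cos_natpi -signr_odd jk -(signr_odd _ k); case: odd; rewrite ?opprK.
Qed.

Lemma sin_spectrum_node_pi {R : realType} (m : nat) (k : 'I_7) :
  sin (spectrum_node (m%:R : R) k * pi) = 0.
Proof.
have [j [_ [->|->]]] := @spectrum_node_nat R m k; first exact: sin_natpi.
by rewrite mulNr sinN sin_natpi oppr0.
Qed.

(** Opposite nodes have equal weights, so their terms pair up; a common denominator gives the sum
    already bounded. *)
Lemma weighted_node_cos_gt0 {R : realType} (m : nat) (t : R) : (1 <= m)%N ->
  0 < t < pi ->
  0 < \sum_k cos (spectrum_node m%:R k * t) / node_deriv m%:R k.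
Proof.
move=> m1 tpi; have wpos := weighted_cos_sum_gt0 _ _ m1 tpi.
set M : R := m%:R; have M1 : 1 <= M by rewrite /M ler1n.
have [n1 n2 n3 n4 n5] : [/\ M != 0, M + 1 != 0, 2 * M + 1 != 0, 2 * M - 1 != 0 & 4 * M + 1 != 0].
  by split; apply: lt0r_neq0; lra.
rewrite !big_ord_recl big_ord0 /spectrum_node /node_deriv /=.
rewrite mul0r cos0 !mulNr !cosN !mul1r addr0.
have E2 : (2 * m)%:R = 2 * M by rewrite natrM.
have E3 : (2 * m).+1%:R = 2 * M + 1 by rewrite -E2 natr1.
move: wpos; rewrite -/M E2 E3; set c1 := cos t; set c2 := cos (2 * M * t).
set c3 := cos ((2 * M + 1) * t) => wpos.
set W := (X in 0 < X) in wpos.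
rewrite [ltRHS](_ : _ = W / (4 * M ^+ 2 * (M + 1) * (2 * M + 1) ^+ 2 * (2 * M - 1) * (4 * M + 1))).
  by rewrite divr_gt0 // !mulr_gt0 ?exprn_gt0 //; lra.
rewrite /W; field; do ?[apply/andP; split] => //.
Qed.

(** * Consequences of perfect state transfer *)

(** A symmetric idempotent equals its product with its transpose, so a diagonal entry is a sum of
    squares. *)
Lemma spectral_proj_diag_ge0 {R : realType} (J : 'M[R]_7) (l : 'I_7 -> R) k i :
  injective l -> (forall k, eigenvalue J (l k)) -> J^T = J ->
  0 <= spectral_proj l J k i i.
Proof.
move=> l_inj l_eig symJ; have := spectral_projM l J l_inj l_eig k k.
rewrite eqxx scale1r => <-; rewrite mxE sumr_ge0 // => s _.
by rewrite -{2}(tr_spectral_proj l J k symJ) mxE -expr2 sqr_ge0.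
Qed.

(** Apply [P k] to the vector identity [sum_j a_j P_j e_o = c e_e]. *)
Lemma orthogonal_proj_extract {F : comRingType} {n : nat} (P : 'I_n -> 'M[F]_n)
    (a : 'I_n -> F) (c : F) (o e : 'I_n) :
  (forall k j, P k *m P j = (j == k)%:R *: P j) ->
  (forall i, \sum_j a j * P j i o = if i == e then c else 0) ->
  forall k r, a k * P k r o = c * P k r e.
Proof.
move=> PP aE k r.
transitivity (\sum_i P k r i * \sum_j a j * P j i o); last first.
  under eq_bigr => i _ do rewrite aE.
  rewrite (bigD1 e) //= eqxx big1 => [|i /negbTE ->]; last by rewrite mulr0.
  by rewrite addr0 mulrC.
under eq_bigr => i _ do rewrite mulr_sumr.
rewrite exchange_big /=.
have term j : \sum_i P k r i * (a j * P j i o) = a j * ((j == k)%:R * P j r o).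
  transitivity (a j * (P k *m P j) r o); last by rewrite PP [in LHS]mxE.
  by rewrite [in RHS]mxE mulr_sumr; apply: eq_bigr => i _; ring.
under eq_bigr => j _ do rewrite term.
rewrite (bigD1 k) //= eqxx mul1r big1 ?addr0 // => j /negbTE ->.
by rewrite mul0r mulr0.
Qed.

(** Real and imaginary parts of [exp(-i l_k T) P_k e_0 = exp(i phi) P_k e_N]. *)
Lemma PST_spectral {R : realType} (J : 'M[R]_7) (l : 'I_7 -> R) (T phi : R) :
  injective l -> (forall k, eigenvalue J (l k)) ->
  (forall i : 'I_7,
    expJ_re J T i ord0 = (if i == ord_max then cos phi else 0) /\
    expJ_im J T i ord0 = (if i == ord_max then sin phi else 0)) ->
  forall k r,
    cos (l k * T) * spectral_proj l J k r ord0 = cos phi * spectral_proj l J k r ord_max /\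
    - sin (l k * T) * spectral_proj l J k r ord0 = sin phi * spectral_proj l J k r ord_max.
Proof.
move=> l_inj l_eig pst k r.
have PP := spectral_projM l J l_inj l_eig.
split.
  apply: (orthogonal_proj_extract _ (fun k => cos (l k * T)) _ _ _ PP) => i.
  by rewrite -expJ_re_spectral //; case: (pst i).
apply: (orthogonal_proj_extract _ (fun k => - sin (l k * T)) _ _ _ PP) => i.
rewrite -(proj2 (pst i)) /expJ_im (expJ_sin_spectral J l) // -sumrN.
by apply: eq_bigr => j _; rewrite mulNr.
Qed.

(** * Transfer at time [pi] and exclusion of earlier zeros *)

Theorem theorem3p2 (R : realType) (m : nat) (J : 'M[R]_7) :
  (1 <= m)%N ->
  is_jacobi J ->
  realizes_PST J ->
  (forall x : R, eigenvalue J x <->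
     x \in [:: 0; 1; -1; (2 * m)%:R; - (2 * m)%:R;
               (2 * m).+1%:R; - (2 * m).+1%:R]) ->
  ~ exhibits_ESE J.
Proof.
move=> m1 jac _ spec [tau [T [[[T0 [phi pst]] earliest] [tau0 [tauT [re0 _]]]]]].
have M1 : 1 <= m%:R :> R by rewrite ler1n.
pose l := @spectrum_node R m%:R.
have l_inj : injective l by exact: spectrum_node_inj.
have l_eig k : eigenvalue J (l k).
  have E2 : (2 * m)%:R = 2 * m%:R :> R by rewrite natrM.
  have E3 : (2 * m).+1%:R = 2 * m%:R + 1 :> R by rewrite -E2 natr1.
  apply/spec; rewrite E2 E3 /l /spectrum_node.
  by case: k => [[|[|[|[|[|[|[|//]]]]]]] k7] /=; rewrite !inE eqxx ?orbT.
have symJ : J^T = J by apply/matrixP => i j; rewrite mxE; case: jac.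
pose P := spectral_proj l J.
have PT k i j : P k i j = P k j i by rewrite /P -{1}(tr_spectral_proj l J k symJ) mxE.
(* The product of the off-diagonal entries [b_1 ... b_6]. *)
pose beta := (J ^+ 6) ord_max ord0.
have beta0 : 0 < beta by apply: (jacobi_pow_col0 J 6 jac).2.
have corner k : P k ord_max ord0 = (-1) ^+ k * (beta / node_deriv m%:R k).
  rewrite /P (spectral_proj_coef l J) => [|r r6]; last first.
    exact: (jacobi_pow_col0 J r jac).1.
  by rewrite prod_node_diff // -/beta; ring.
have w0 k : 0 < beta / node_deriv m%:R k by rewrite divr_gt0 // node_deriv_gt0.
have transfer := PST_spectral J l T phi l_inj l_eig pst.
have diag k : P k ord0 ord0 = beta / node_deriv m%:R k.
  have [Pre Pim] := transfer k ord0; rewrite -/P in Pre Pim.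
  have P0 : 0 <= P k ord0 ord0 by exact: spectral_proj_diag_ge0.
  apply/eqP; rewrite -(eqrXn2 (n := 2)) // ?ltW //; apply/eqP.
  transitivity (P k ord0 ord_max ^+ 2).
    (* Adding the squares of the real and imaginary identities removes both phases. *)
    rewrite -[LHS]mul1r -(cos2Dsin2 (l k * T)) -[RHS]mul1r -(cos2Dsin2 phi).
    by rewrite !mulrDl -!exprMn Pre -Pim mulNr sqrrN.
  by rewrite PT corner exprMn sqrr_sign mul1r.
have mirror k r : P k r ord_max = (-1) ^+ k * P k r ord0.
  (* [eps] is [cos (phi + l k * T)], the real part of the phase relating the two columns; row 0,
     where both entries are known and nonzero, determines it. *)
  pose eps := cos phi * cos (l k * T) - sin phi * sin (l k * T).
  have epsP i : P k i ord_max = eps * P k i ord0.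
    have [Pre Pim] := transfer k i; rewrite -/P in Pre Pim.
    rewrite -[LHS]mul1r -(cos2Dsin2 phi) mulrDl !expr2 -!mulrA -Pre -Pim /eps; ring.
  suff epsE : eps = (-1) ^+ k by rewrite epsP epsE.
  have := epsP ord0; rewrite PT corner diag => /esym.
  by apply: mulIf; apply: lt0r_neq0.
have pst_pi : PST_at J pi.
  split; first exact: pi_gt0.
  (* The sign of [cos (l k * pi)] cancels the mirror sign up to [-1], so [e_0] goes to [- e_N], with
     phase [pi]. *)
  exists pi => i; rewrite /expJ_im (expJ_re_spectral J l) // (expJ_sin_spectral J l) //.
  split; last first.
    rewrite sinpi big1 ?oppr0 => [|k _]; first by case: ifP.
    by rewrite sin_spectrum_node_pi mul0r.
  transitivity (- (\sum_k P k) i ord_max).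
    rewrite summxE -sumrN; apply: eq_bigr => k _.
    by rewrite cos_spectrum_node_pi mirror mulNr.
  by rewrite sum_spectral_proj // mxE cospi; case: eqP => _; rewrite ?oppr0.
have Tpi : T <= pi.
  by rewrite leNgt; apply/negP => piT; apply: (earliest pi) => //; exact: pi_gt0.
have : 0 < tau < pi by rewrite tau0 (lt_le_trans tauT).
move=> /(weighted_node_cos_gt0 m tau m1); rewrite -(pmulr_rgt0 _ beta0).
(* By [diag], this is the real part of the return amplitude at [tau], assumed to vanish. *)
suff -> : beta * \sum_k cos (spectrum_node m%:R k * tau) / node_deriv m%:R k = 0.
  by rewrite ltxx.
rewrite -{2}re0 (expJ_re_spectral J l) // mulr_sumr; apply: eq_bigr => k _.
by rewrite -/(P k) diag /l; ring.
Qed.
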